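(* Let $\mu$ be a c.d.f.-unimodal Borel probability measure on $\mathbb{R}$. Then its quantile function $Q_\mu:(0,1)\to\mathbb{R}$ is absolutely continuous, i.e., there exists a measurable function $q_\mu:(0,1)\to[0,+\infty]$ such that $Q_\mu(y)-Q_\mu(x)=\int_x^y q_\mu\,\mathrm{d}\lambda$ for all $x,y\in(0,1)$.
   Context: $\lambda$ denotes Lebesgue measure. For a probability measure $\mu$ on $(\mathbb{R},\mathcal{B}(\mathbb{R}))$, the cumulative distribution function is $F_\mu(x)=\mu((-\infty,x])$, $x\in\mathbb{R}$, and the quantile function is $Q_\mu(t)=\inf\{x\in\mathbb{R} : t\le F_\mu(x)\}$, $t\in(0,1)$. The measure $\mu$ is called c.d.f.-unimodal if there exists $\nu\in\mathbb{R}$ (a mode) such that $F_\mu$ is convex on $(-\infty,\nu]$ and concave on $[\nu,+\infty)$ (so $\mu$ need not be absolutely continuous; it may have an atom at $\nu$). *)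

(* Defs.v *)
From mathcomp Require Export all_boot all_order all_algebra.
From mathcomp Require Export all_classical all_reals all_analysis measurable_realfun.
Export Order.TTheory GRing.Theory Num.Theory.
Export numFieldNormedType.Exports.

Set Implicit Arguments.
Unset Strict Implicit.
Unset Printing Implicit Defensive.

Local Open Scope classical_set_scope.
Local Open Scope ring_scope.

(* F_mu; [fine] loses nothing, mu being a probability. *)
Definition cdf_of (R : realType) (mu : probability (measurableTypeR R) R)
    (x : R) : R :=
  fine (mu `]-oo, x]%classic).

(* Q_mu. Only meaningful for 0 < t < 1, where the set is nonempty and bounded
   below; elsewhere [inf] may return its default value 0. *)
Definition quantile (R : realType) (mu : probability (measurableTypeR R) R)
    (t : R) : R :=
  inf [set x : R | t <= cdf_of mu x].

(* The library has no concave functions: f is concave when - f is convex. *)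
Definition concave_function (R : realType) (D : set R) (f : R -> R) : Prop :=
  convex_function (D : set R^o) (fun x : R^o => - f x).

Definition cdf_unimodal (R : realType)
    (mu : probability (measurableTypeR R) R) : Prop :=
  exists nu : R,
    convex_function (`]-oo, nu]%classic : set R^o) (cdf_of mu) /\
    concave_function `[nu, +oo[%classic (cdf_of mu).

(* Lebesgue integral of f from x to y with the usual sign convention
   \int_x^y = - \int_y^x when y < x. *)
Definition oriented_integral (R : realType) (f : R -> \bar R) (x y : R)
    : \bar R :=
  if x <= y then (\int[@lebesgue_measure R]_(t in `[x, y]) f t)%E
  else (- \int[@lebesgue_measure R]_(t in `[y, x]) f t)%E.

(* Main.v *)
(* The quantile function inverts the c.d.f. F, so with c = F(nu) it is concave
   on (0, c] and convex on [c, 1); this needs that Q >= nu on [c, 1), i.e. that F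
   has no plateau to the left of nu.  A nondecreasing convex function is the
   integral of any of its subgradients: a subgradient is monotone, so bisecting
   [x, y] bounds the error by its total increment times a vanishing mesh.  The
   concave half follows by reflecting through the origin, and the two densities
   are glued at c, whose Lebesgue measure is zero. *)
From HB Require Import structures.
Require Import Defs.
From mathcomp Require Import ring lra.

Set Implicit Arguments.
Unset Strict Implicit.
Unset Printing Implicit Defensive.

Local Open Scope classical_set_scope.
Local Open Scope ring_scope.

(** * Subgradients on an interval and their integrals *)

(** By monotonicity, the preimage in [D] of a ray [[r, +oo[] is again an interval, and such rays
    generate the Borel sets. *)
Lemma nondecreasing_in_measurable (R : realType) (D : set R) (g : R -> R) :
  is_interval D -> (forall s t, D s -> D t -> s <= t -> g s <= g t) ->
  measurable_fun D g.
Proof.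
move=> iD g_nd; have mD := is_interval_measurable iD.
apply: (measurability (@RGenCInfty.G R)) => [|/= _ [_] [r] -> <-].
  exact: RGenCInfty.measurableE.
apply: is_interval_measurable => s t /= [Ds].
rewrite !in_itv/= !andbT => rs [Dt _] u /andP[su ut].
have Du : D u by apply: (iD s t) => //; rewrite su.
by split=> //; rewrite in_itv/= andbT (le_trans rs)// g_nd.
Qed.

(** The two bounds are the subgradient inequalities at [s] and at [t]. Only pairs in [D] are
    compared, so an endpoint of [D] is constrained from one side only. *)
Definition subgradient (R : realType) (D : set R) (f g : R -> R) : Prop :=
  forall s t, D s -> D t -> s < t ->
    g s * (t - s) <= f t - f s <= g t * (t - s).

Section subgradient.
Context (R : realType) (D : set R) (f g : R -> R).
Hypotheses (iD : is_interval D) (fg : subgradient D f g).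
Local Notation mu := (@lebesgue_measure R).

Lemma subgradient_nondecreasing s t : D s -> D t -> s <= t -> g s <= g t.
Proof.
move=> Ds Dt; rewrite le_eqVlt => /predU1P[->//|st].
have /andP[/le_trans h /h] := fg Ds Dt st.
by rewrite ler_pM2r// subr_gt0.
Qed.

Lemma subgradient_measurable : measurable_fun D g.
Proof.
exact: nondecreasing_in_measurable iD subgradient_nondecreasing.
Qed.

Lemma subgradient_itv x y t : D x -> D y -> t \in `[x, y] -> D t.
Proof. by move=> Dx Dy; rewrite in_itv/=; exact: iD. Qed.

Lemma subgradient_integrable x y : D x -> D y ->
  mu.-integrable `[x, y] (EFin \o g).
Proof.
move=> Dx Dy; apply: measurable_bounded_integrable => //.
- by rewrite /= lebesgue_measure_itv/=; case: ifP => _; rewrite ?ltry.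
- have sub : `[x, y] `<=` D by move=> t; exact: subgradient_itv.
  apply: measurable_funS sub subgradient_measurable.
  exact: is_interval_measurable.
(* A monotone [g] stays between [g x] and [g y]; the sum of absolute values bounds it whatever their
   signs. *)
exists (`|g x| + `|g y|); split; first exact: num_real.
move=> M ltM t /= txy; apply/ltW; apply: le_lt_trans ltM.
have Dt := subgradient_itv Dx Dy txy.
move: txy; rewrite in_itv/= => /andP[xt ty].
have gxt := subgradient_nondecreasing Dx Dt xt.
have gty := subgradient_nondecreasing Dt Dy ty.
rewrite ler_norml; apply/andP; split.
  have := ler_norm (- g x); rewrite normrN; have := normr_ge0 (g y); lra.
have := ler_norm (g y); have := normr_ge0 (g x); lra.
Qed.

Lemma subgradient_Rintegral_bounds x y : D x -> D y -> x <= y ->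
  g x * (y - x) <= \int[mu]_(t in `[x, y]) g t <= g y * (y - x).
Proof.
move=> Dx Dy xy.
have cstE r : \int[mu]_(t in `[x, y]) r = r * (y - x).
  rewrite Rintegral_cst//; congr (_ * _); rewrite /= lebesgue_measure_itv/= lte_fin.
  move: xy; rewrite le_eqVlt => /predU1P[->|->//].
  by rewrite ltxx subrr.
have icst r : mu.-integrable `[x, y] (EFin \o cst r).
  apply: measurable_bounded_integrable => //; last exact: bounded_cst.
  by rewrite /= lebesgue_measure_itv/=; case: ifP => _; rewrite ?ltry.
rewrite -!cstE; apply/andP; split; apply: le_Rintegral => //=;
  (try exact: icst); (try exact: subgradient_integrable) => t txy;
  have Dt := subgradient_itv Dx Dy txy;
  move: txy; rewrite in_itv/= => /andP[xt ty];
  exact: subgradient_nondecreasing.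
Qed.

(* Bisection: both quantities are additive in the interval and lie between
   [g x * (y - x)] and [g y * (y - x)]; halving the interval halves the bound,
   because the increments of [g] over the two halves add up. *)
Lemma subgradient_Rintegral_approx n x y : D x -> D y -> x <= y ->
  `|f y - f x - \int[mu]_(t in `[x, y]) g t| <=
    (g y - g x) * (y - x) / 2 ^+ n.
Proof.
elim: n x y => [|n IHn] x y Dx Dy xy.
  rewrite expr0 divr1 ler_norml.
  have /andP[] := subgradient_Rintegral_bounds Dx Dy xy.
  have : g x * (y - x) <= f y - f x <= g y * (y - x).
    move: xy Dx Dy; rewrite le_eqVlt => /predU1P[->|xy Dx Dy]; last exact: fg.
    by rewrite !subrr !mulr0 lexx.
  move=> /andP[]; lra.
pose m := (x + y) / 2.
have xm : x <= m by rewrite /m; lra.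
have my : m <= y by rewrite /m; lra.
have Dm : D m by apply: (iD Dx Dy); rewrite xm.
have intE : \int[mu]_(t in `[x, y]) g t =
    \int[mu]_(t in `[x, m]) g t + \int[mu]_(t in `[m, y]) g t.
  have ixy := subgradient_integrable Dx Dy.
  have := @Rintegral_itvB R g (BLeft x) (BRight y) m ixy.
  rewrite !bnd_simp => /(_ xm my).
  rewrite Rintegral_itv_obnd_cbnd => [<-|]; first by rewrite addrC subrK.
  apply: integrableS (subgradient_integrable Dm Dy) => //.
  exact: subset_itv_oc_cc.
have {}IH1 := IHn x m Dx Dm xm; have {}IH2 := IHn m y Dm Dy my.
rewrite (_ : f y - f x - _ =
  (f m - f x - \int[mu]_(t in `[x, m]) g t) +
  (f y - f m - \int[mu]_(t in `[m, y]) g t)); last by rewrite intE; ring.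
apply: le_trans (ler_normD _ _) _; apply: le_trans (lerD IH1 IH2) _.
rewrite le_eqVlt; apply/orP; left; apply/eqP.
have n2 : 2 ^+ n != 0 :> R by rewrite expf_neq0.
rewrite exprS /m; field.
by rewrite n2.
Qed.

Lemma subgradient_Rintegral x y : D x -> D y -> x <= y ->
  \int[mu]_(t in `[x, y]) g t = f y - f x.
Proof.
move=> Dx Dy xy; apply/esym/eqP; rewrite -subr_eq0 -normr_eq0 eq_le normr_ge0 andbT.
apply/ler_addgt0Pl => e e0; rewrite addr0.
set C := (g y - g x) * (y - x).
have [n Cn] : exists n, C / 2 ^+ n <= e.
  (* This [n] satisfies [C / e < n <= 2 ^+ n]. *)
  exists (Num.bound `|C / e|).
  rewrite ler_pdivrMr ?exprn_gt0// mulrC -ler_pdivrMr//.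
  apply: le_trans (ler_norm _) _; apply/ltW/(lt_le_trans (archi_boundP _)) => //.
  by rewrite -natrX ler_nat; exact: ltnW (ltn_expl _ _).
exact: le_trans (subgradient_Rintegral_approx n Dx Dy xy) Cn.
Qed.

End subgradient.

(** * Existence of subgradients for monotone convex and concave functions *)

Section convex.
Context (R : realType).
Implicit Types (D : set R) (f : R -> R).

Lemma convex_functionP D f : convex_function (D : set R^o) f <->
  forall l x y, 0 <= l -> l <= 1 -> D x -> D y ->
    f (l * x + (1 - l) * y) <= l * f x + (1 - l) * f y.
Proof.
split=> [cf l x y l0 l1 Dx Dy|cf l x y /set_mem Dx /set_mem Dy].
  exact: cf (Itv01 l0 l1) x y (mem_set Dx) (mem_set Dy).
exact: cf.
Qed.

Lemma convex_function_slope D f s t u :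
  convex_function (D : set R^o) f -> D s -> D u -> s < t -> t < u ->
  (f t - f s) / (t - s) <= (f u - f t) / (u - t).
Proof.
move=> /convex_functionP cf Ds Du st tu.
have us : 0 < u - s by lra.
(* The weight that makes [t] the combination [l * s + (1 - l) * u]. *)
pose l := (u - t) / (u - s).
have l0 : 0 <= l by rewrite divr_ge0; lra.
have l1 : l <= 1 by rewrite ler_pdivrMr// mul1r; lra.
have := cf l s u l0 l1 Ds Du.
have -> : l * s + (1 - l) * u = t by rewrite /l; field; rewrite gt_eqF.
have -> : l * f s + (1 - l) * f u = ((u - t) * f s + (t - s) * f u) / (u - s).
  by rewrite /l; field; rewrite gt_eqF.
rewrite ler_pdivlMr// => h.
rewrite ler_pdivrMr ?subr_gt0// mulrAC ler_pdivlMr ?subr_gt0//.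
nra.
Qed.

(* The subgradient is the left derivative, taken as the supremum of the slopes
   to the left; at the left endpoint of [D], if any, it is [sup set0 = 0],
   which is a subgradient because [f] is nondecreasing. *)
Lemma convex_subgradient D f :
  (forall t, D t -> exists2 u, D u & t < u) ->
  convex_function (D : set R^o) f ->
  (forall s t, D s -> D t -> s <= t -> f s <= f t) ->
  exists2 g, subgradient D f g & forall t, D t -> 0 <= g t.
Proof.
move=> Dright cf ndf.
pose slopes t := [set (f t - f s) / (t - s) | s in [set s | D s /\ s < t]].
have slope_ge0 s t : D s -> D t -> s < t -> 0 <= (f t - f s) / (t - s).
  by move=> Ds Dt st; rewrite divr_ge0// subr_ge0 ?ndf// ltW.
have slopes_ub t u : D t -> D u -> t < u ->
    ubound (slopes t) ((f u - f t) / (u - t)).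
  by move=> Dt Du tu _ [s [Ds st] <-]; exact: convex_function_slope cf Ds Du _ _.
have slopes_sup s t : D s -> D t -> s < t ->
    (f t - f s) / (t - s) <= sup (slopes t).
  (* The slope from [t] to a point of [D] on its right bounds all left slopes at [t], so this [sup]
     is a genuine one. *)
  move=> Ds Dt st; have [u Du tu] := Dright _ Dt.
  apply: ub_le_sup; first by eexists; exact: slopes_ub Dt Du tu.
  by exists s.
exists (sup \o slopes) => [s t Ds Dt st|t Dt] /=.
  have ts : 0 < t - s by rewrite subr_gt0.
  rewrite -ler_pdivlMr// -[X in _ && X]ler_pdivrMr// slopes_sup// andbT.
  have [->|/set0P ne] := eqVneq (slopes s) set0; first by rewrite sup0 slope_ge0.
  by apply: ge_sup => //; exact: slopes_ub.
have [->|/set0P[_ [s [Ds st] _]]] := eqVneq (slopes t) set0; first by rewrite sup0.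
exact: le_trans (slope_ge0 _ _ Ds Dt st) (slopes_sup _ _ Ds Dt st).
Qed.

(** Negation alone would make [f] nonincreasing; the reflection [- f (- t)] is convex and still
    nondecreasing, and its subgradient [g] gives [h t = g (- t)]. The conclusion on [\- f] and
    [\- h] says that [h] is a supergradient of [f]. *)
Lemma concave_subgradient D f :
  (forall t, D t -> exists2 u, D u & u < t) ->
  concave_function D f ->
  (forall s t, D s -> D t -> s <= t -> f s <= f t) ->
  exists2 h, subgradient D (\- f) (\- h) & forall t, D t -> 0 <= h t.
Proof.
move=> Dleft cf ndf.
have [||s t Ds Dt st|g gf g0] := @convex_subgradient [set t | D (- t)] (fun t => - f (- t)).
- by move=> t /Dleft[u Du ut]; exists (- u); rewrite /= ?opprK// ltrNr.
- apply/convex_functionP => l x y l0 l1 Dx Dy.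
  have /convex_functionP/(_ l _ _ l0 l1 Dx Dy) := cf.
  by rewrite opprD -!mulrN.
- by rewrite lerN2 ndf// lerN2.
exists (g \o -%R) => [s t Ds Dt st|t Dt]; last by apply: g0; rewrite /= opprK.
have := gf (- t) (- s); rewrite /= !opprK ltrN2 => /(_ Dt Ds st).
rewrite !mulNr; lra.
Qed.

End convex.

(** * The c.d.f. and the quantile function as its generalized inverse *)

Section quantile.
Context (R : realType) (mu : probability (measurableTypeR R) R).
Local Notation F := (cdf_of mu).
Local Notation Q := (quantile mu).

(** The identity as a random variable: its [cdf] is [F], which gives access to the limits of [F] at
    both infinities. *)
Let idTR : measurableTypeR R -> R := idfun.

#[local] HB.instance Definition _ :=
  @isMeasurableFun.Build _ _ _ _ idTR (@measurable_id _ _ setT).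

Lemma cdf_ofE x : F x = fine (cdf (idTR : {RV mu >-> R}) x).
Proof. by []. Qed.

Lemma cdf_of_nondecreasing x y : x <= y -> F x <= F y.
Proof.
by move=> xy; rewrite !cdf_ofE fine_le ?fin_num_measure ?cdf_nondecreasing.
Qed.

Lemma cdf_of_lt e : 0 < e -> exists x, F x < e.
Proof.
move=> e0; have /fine_cvgP[_] := cvg_cdfNy0 (idTR : {RV mu >-> R}).
move=> /cvgr_lt/(_ _ e0)[M [_]] /(_ (M - 1)) h.
by exists (M - 1); apply: h; rewrite ltrBlDr ltrDl.
Qed.

Lemma cdf_of_gt e : e < 1 -> exists x, e < F x.
Proof.
move=> e1; have /fine_cvgP[_] := cvg_cdfy1 (idTR : {RV mu >-> R}).
move=> /cvgr_gt/(_ _ e1)[M [_]] /(_ (M + 1)) h.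
by exists (M + 1); apply: h; rewrite ltrDl.
Qed.

Lemma cdf_of_lt_mono x y : F x < F y -> x < y.
Proof. by apply: contraTT; rewrite -!leNgt; exact: cdf_of_nondecreasing. Qed.

Let has_inf_quantile (t : R) : 0 < t < 1 -> has_inf [set x | t <= F x].
Proof.
move=> /andP[t0 t1]; split.
  by have [x tx] := cdf_of_gt t1; exists x; exact: ltW.
have [x xt] := cdf_of_lt t0; exists x => y /= ty.
by apply/ltW/cdf_of_lt_mono/(lt_le_trans xt).
Qed.

Lemma quantile_le t x : 0 < t < 1 -> t <= F x -> Q t <= x.
Proof. by move=> /has_inf_quantile[_ h] tx; exact: ge_inf. Qed.

Lemma le_quantile t x : 0 < t < 1 ->
  (forall y, t <= F y -> x <= y) -> x <= Q t.
Proof. by move=> /has_inf_quantile[h _] tx; exact: lb_le_inf. Qed.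

(** Strictness provides some [y < x] with [t <= F y], and monotonicity carries this to [x]. The
    later shift [Q r + e] creates this slack. *)
Lemma cdf_of_ge t x : 0 < t < 1 -> Q t < x -> t <= F x.
Proof.
move=> t01 Qx; have [|y /= ty] := @inf_adherent _ _ (x - Q t) _ (has_inf_quantile t01).
  by rewrite subr_gt0.
rewrite -/(Q t) addrC subrK => yx.
exact: le_trans ty (cdf_of_nondecreasing (ltW yx)).
Qed.

Lemma quantile_nondecreasing s t :
  0 < s < 1 -> 0 < t < 1 -> s <= t -> Q s <= Q t.
Proof.
by move=> s01 t01 st; apply: le_quantile => // x /(le_trans st); exact: quantile_le.
Qed.

Lemma conv_in01 (l s t : R) : 0 <= l -> l <= 1 -> 0 < s < 1 -> 0 < t < 1 ->
  0 < l * s + (1 - l) * t < 1.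
Proof.
move=> l0 l1 /andP[s0 s1] /andP[t0 t1].
have [->|ln0] := eqVneq l 0; first by rewrite mul0r add0r subr0 mul1r t0.
have lp : 0 < l by rewrite lt_neqAle eq_sym ln0.
apply/andP; split; nra.
Qed.

(** * Concavity and convexity of the quantile function below and above the level of the mode *)

Section unimodal.
Variable nu : R.
Hypothesis cvxF : convex_function (`]-oo, nu]%classic : set R^o) F.
Hypothesis ccvF : concave_function `[nu, +oo[%classic F.

(** If [z] is less than the combination of [Q s] and [Q t], shift both points left by the gap [e]:
    there [F] is below [s] and [t], so convexity puts [F z] strictly below [l * s + (1 - l) * t].
    The shifted points stay left of [nu] because [s] and [t] are at most [F nu]. *)
Lemma quantile_concave : concave_function [set t | 0 < t < 1 /\ t <= F nu] Q.
Proof.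
apply/convex_functionP => l s t l0 l1 [s01 sc] [t01 tc].
rewrite [leRHS](_ : _ = - (l * Q s + (1 - l) * Q t)); last by ring.
rewrite lerN2.
apply: le_quantile => [|z]; first exact: conv_in01.
have Qs := quantile_le s01 sc; have Qt := quantile_le t01 tc.
apply: contraTT; rewrite -!ltNge => zX.
pose e := l * Q s + (1 - l) * Q t - z.
have e0 : 0 < e by rewrite subr_gt0.
have lt_cdf r : 0 < r < 1 -> F (Q r - e) < r.
  move=> r01; rewrite ltNge; apply/negP => /(quantile_le r01); lra.
have Fs := lt_cdf _ s01; have Ft := lt_cdf _ t01.
have /convex_functionP/(_ l (Q s - e) (Q t - e) l0 l1) := cvxF.
rewrite /= !in_itv/= (_ : l * _ + _ = z); last by rewrite /e; ring.
move=> /(_ _ _)/le_lt_trans; apply; [lra|lra|].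
(* The strict inequality comes from the term in [t] when [l = 0], and from the term in [s]
   otherwise. *)
have [->|ln0] := eqVneq l 0; first by rewrite !mul0r !add0r subr0 !mul1r.
have lp : 0 < l by rewrite lt_neqAle eq_sym ln0.
by apply: ltr_leD; [rewrite ltr_pM2l|rewrite ler_wpM2l ?subr_ge0// ltW].
Qed.

(* Convexity together with [F -> 0] at [-oo] forbids a plateau of positive
   height to the left of the mode. *)
Lemma cdf_of_lt_mode z : z < nu -> 0 < F nu -> F z < F nu.
Proof.
move=> znu c0; rewrite ltNge; apply/negP => cz.
have [w wc] := cdf_of_lt c0.
have wz : w < z by apply: cdf_of_lt_mono; exact: lt_le_trans wc cz.
have := @convex_function_slope _ _ _ w z nu cvxF.
rewrite /= !in_itv/= lexx => /(_ (ltW (lt_trans wz znu)) isT wz znu).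
apply/negP; rewrite -ltNge.
apply: (@le_lt_trans _ _ 0).
  by rewrite ler_pdivrMr ?subr_gt0// mul0r subr_le0.
by rewrite divr_gt0 ?subr_gt0//; exact: lt_le_trans wc cz.
Qed.

(** Places [Q] where [F] is concave. A point [z < nu] with [t <= F z] would force [F z = F nu > 0],
    a plateau left of the mode. *)
Lemma mode_le_quantile t : 0 < t < 1 -> F nu <= t -> nu <= Q t.
Proof.
move=> t01 ct; apply: le_quantile => // z tz; rewrite leNgt; apply/negP => znu.
have t0 : 0 < t by case/andP: t01.
have Fz := cdf_of_nondecreasing (ltW znu).
have := @cdf_of_lt_mode z znu (lt_le_trans t0 (le_trans tz Fz)); lra.
Qed.

(** Shifting right by [e] gives [r <= F (Q r + e)] for [r = s, t]; concavity of [F] passes this to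
    the combination, and [e] is arbitrary. *)
Lemma quantile_convex :
  convex_function ([set t | 0 < t < 1 /\ F nu <= t] : set R^o) Q.
Proof.
apply/convex_functionP => l s t l0 l1 [s01 sc] [t01 tc].
apply/ler_addgt0Pr => e e0.
have Qs := mode_le_quantile s01 sc; have Qt := mode_le_quantile t01 tc.
apply: quantile_le; first exact: conv_in01.
have cdf_ge r : 0 < r < 1 -> r <= F (Q r + e).
  by move=> r01; apply: cdf_of_ge => //; rewrite ltrDl.
have Fs := cdf_ge _ s01; have Ft := cdf_ge _ t01.
have /convex_functionP/(_ l (Q s + e) (Q t + e) l0 l1) := ccvF.
rewrite /= !in_itv/= !andbT (_ : l * (_ + _) + _ = l * Q s + (1 - l) * Q t + e); last ring.
move=> /(_ _ _) h.
have {}h : l * F (Q s + e) + (1 - l) * F (Q t + e) <= F (l * Q s + (1 - l) * Q t + e).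
  rewrite -lerN2 opprD -!mulrN; apply: h; lra.
apply: le_trans h; apply: lerD; apply: ler_wpM2l => //; lra.
Qed.

End unimodal.
End quantile.

(** * Extended-real integrals and gluing of the two densities *)

Lemma subgradient_integral (R : realType) (D : set R) (f g : R -> R) x y :
  is_interval D -> subgradient D f g -> D x -> D y -> x <= y ->
  (\int[@lebesgue_measure R]_(t in `[x, y]) (g t)%:E)%E = (f y - f x)%:E.
Proof.
move=> iD fg Dx Dy xy; rewrite -(subgradient_Rintegral iD fg Dx Dy xy).
by rewrite fineK// integrable_fin_num//; exact: subgradient_integrable iD fg _ _ Dx Dy.
Qed.

Lemma supergradient_integral (R : realType) (D : set R) (f h : R -> R) x y :
  is_interval D -> subgradient D (\- f) (\- h) -> D x -> D y -> x <= y ->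
  (\int[@lebesgue_measure R]_(t in `[x, y]) (h t)%:E)%E = (f y - f x)%:E.
Proof.
move=> iD fh Dx Dy xy.
have ih := subgradient_integrable iD fh Dx Dy.
apply: oppe_inj; rewrite -EFinN opprB.
transitivity (- f y - - f x)%:E; last by rewrite opprK addrC.
rewrite -(subgradient_integral iD fh Dx Dy xy).
under [in RHS]eq_integral do rewrite EFinN.
rewrite integralN//; apply: integrable_add_def => //.
apply: (eq_integrable _ _ _ _ (integrableN ih)) => //.
by move=> t _; rewrite /= opprK.
Qed.

Theorem theorem1p5 (R : realType) (mu : probability (measurableTypeR R) R)
    (hmu : cdf_unimodal mu) :
  exists q : R -> \bar R,
    [/\ measurable_fun (`]0, 1[%classic : set R) q,
        (forall t : R, t \in `]0, 1[ -> (0 <= q t)%E) &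
        (forall x y : R, x \in `]0, 1[ -> y \in `]0, 1[ ->
           (quantile mu y - quantile mu x)%:E = oriented_integral q x y)].
Proof.
have [nu [cvxF ccvF]] := hmu.
set c := cdf_of mu nu; set Q := quantile mu.
(* [L] is empty when [c = 0] and [U] when [c = 1], so a mode at an extreme level is no separate
   case. *)
pose L : set R := [set t | 0 < t < 1 /\ t <= c].
pose U : set R := [set t | 0 < t < 1 /\ c <= t].
have iL : is_interval L.
  move=> x y [/andP[x0 x1] xc] [/andP[y0 y1] yc] z /andP[xz zy].
  by split; [apply/andP; split|]; lra.
have iU : is_interval U.
  move=> x y [/andP[x0 x1] xc] [/andP[y0 y1] yc] z /andP[xz zy].
  by split; [apply/andP; split|]; lra.
have [||s t [s01 _] [t01 _]|h hQ h0] := @concave_subgradient R L Q.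
- move=> t [/andP[t0 t1] tc]; exists (t / 2); last lra.
  by split; [apply/andP; split|]; lra.
- exact: quantile_concave.
- exact: quantile_nondecreasing.
have [||s t [s01 _] [t01 _]|g gQ g0] := @convex_subgradient R U Q.
- move=> t [/andP[t0 t1] tc]; exists ((t + 1) / 2); last lra.
  by split; [apply/andP; split|]; lra.
- exact: quantile_convex.
- exact: quantile_nondecreasing.
pose q t := (if t <= c then h t else g t)%:E.
have q_ge0 (t : R) : 0 < t < 1 -> (0 <= q t)%E.
  move=> t01; rewrite /q lee_fin; case: (leP t c) => [tc|/ltW ct]; first exact: h0 (conj t01 tc).
  exact: g0 (conj t01 ct).
have mq : measurable_fun (`]0, 1[%classic : set R) q.
  apply/measurable_EFinP.
  (* With [c] removed from [U], [q] coincides exactly with [h] on one piece and with [g] on the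
     other. *)
  have -> : `]0, 1[%classic = L `|` (U `\ c) :> set R.
    apply/seteqP; split => [t|t]; rewrite /= in_itv/=.
      move=> t01; have [tc|ct] := leP t c; [by left|right].
      by split; [split=> //; exact: ltW|move=> /= tc; rewrite tc ltxx in ct].
    by case=> -[] // [].
  apply/measurable_funU.
  - exact: is_interval_measurable.
  - apply: measurableD => //; exact: is_interval_measurable.
  split.
  - apply: (eq_measurable_fun h) => [t /set_mem[_ tc]|]; first by rewrite tc.
    have /measurable_funN := subgradient_measurable iL hQ.
    by apply: eq_measurable_fun => t _; rewrite /= opprK.
  - apply: (eq_measurable_fun g) => [t /set_mem[[_ ct] /= /eqP tc]|].
      by rewrite leNgt lt_neqAle eq_sym tc ct.
    apply: measurable_funS (subgradient_measurable iU gQ) => //.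
    exact: is_interval_measurable.
(* The boolean [b] covers both [[x, y]] and []x, y]]. *)
have mq_itv b (x y : R) : 0 < x -> y < 1 ->
    measurable_fun [set` Interval (BSide b x) (BRight y)] q.
  move=> x0 y1; apply: measurable_funS mq => //.
  move=> t /=; rewrite !in_itv/=; case: b => /= /andP[xt ty]; apply/andP; split; lra.
have lower x y : L x -> L y -> x <= y ->
    (\int[@lebesgue_measure R]_(t in `[x, y]) q t = (Q y - Q x)%:E)%E.
  move=> Lx Ly xy; rewrite -(supergradient_integral iL hQ Lx Ly xy).
  apply: eq_integral => t; rewrite inE /= => /(subgradient_itv iL Lx Ly)[_ tc].
  by rewrite /q tc.
(* [q] and [g] may differ at [c], which is a null set. *)
have upper x y : U x -> U y -> x <= y ->
    (\int[@lebesgue_measure R]_(t in `]x, y]) q t = (Q y - Q x)%:E)%E.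
  move=> Ux Uy xy; rewrite -(subgradient_integral iU gQ Ux Uy xy).
  rewrite -integral_itv_obnd_cbnd; last first.
    apply/measurable_EFinP.
    apply: measurable_funS (subgradient_measurable iU gQ) => //.
      exact: is_interval_measurable.
    by move=> t /subset_itv_oc_cc; exact: subgradient_itv iU _ _ _ Ux Uy.
  apply: eq_integral => t; rewrite inE /= in_itv/= => /andP[xt _].
  by case: Ux => _ cx; rewrite /q leNgt (le_lt_trans cx xt).
have split_itv (x z y : R) : 0 < x -> x <= z -> z <= y -> y < 1 ->
    (\int[@lebesgue_measure R]_(t in `[x, y]) q t =
     \int[@lebesgue_measure R]_(t in `[x, z]) q t +
     \int[@lebesgue_measure R]_(t in `]z, y]) q t)%E.
  move=> x0 xz zy y1.
  (* Additivity rests on [q >= 0], without knowing yet that [q] is integrable. *)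
  rewrite -ge0_integral_setU//.
  - by rewrite -itv_bndbnd_setU// bnd_simp.
  - by rewrite -itv_bndbnd_setU ?bnd_simp//; exact: mq_itv.
  - rewrite -itv_bndbnd_setU ?bnd_simp// => t /=; rewrite in_itv/= => /andP[xt ty].
    by apply: q_ge0; rewrite (lt_le_trans x0 xt) (le_lt_trans ty y1).
  apply/disj_setPS => t [/=]; rewrite !in_itv/= => /andP[_ tz] /andP[].
  by rewrite ltNge tz.
have main (x y : R) : 0 < x < 1 -> 0 < y < 1 -> x <= y ->
    (\int[@lebesgue_measure R]_(t in `[x, y]) q t = (Q y - Q x)%:E)%E.
  move=> x01 y01 xy; have [x0 x1] := andP x01; have [y0 y1] := andP y01.
  have [yc|cy] := leP y c.
    by apply: lower => //; split=> //; exact: le_trans yc.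
  have [cx|xc] := leP c x.
    rewrite -(integral_itv_obnd_cbnd (mq_itv false _ _ x0 y1)).
    by apply: upper => //; split=> //; exact: ltW.
  (* Here [x < c < y], so [c] belongs to both [L] and [U] and can serve as the splitting point. *)
  have c01 : 0 < c < 1 by rewrite (lt_trans x0 xc) (lt_trans cy y1).
  rewrite (split_itv x c y x0 (ltW xc) (ltW cy) y1).
  rewrite (lower x c (conj x01 (ltW xc)) (conj c01 (lexx c)) (ltW xc)).
  rewrite (upper c y (conj c01 (lexx c)) (conj y01 (ltW cy)) (ltW cy)).
  by rewrite -EFinD addrC subrKA.
exists q; split => // x y; rewrite !in_itv/= => x01 y01.
rewrite /oriented_integral; case: (leP x y) => [xy|/ltW yx].
  by rewrite main.
by rewrite main// -EFinN opprB.
Qed.
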